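(* For all $k\geq 1$, $$\sum_{n\geq 0} I^e_{12\cdots k}(n)\,x^n=\sum_{j=0}^{k-1}\left(x^j\Bigl(1+x^2R^e_{k-1-j}(x^2)\,F_{k-j}(x)\Bigr)\prod_{i=k-j}^{k}R_i(-x^2)\right),$$ where $F_m(x)=\dfrac{1}{x\,U_m\!\left(\frac{1}{2x}\right)}\sum_{j=0}^{m-1}U_j\!\left(\frac{1}{2x}\right)$.
   Context: For a pattern $\tau$, $I^e_\tau(n)$ is the number of even involutions $\pi\in\mathfrak{S}_n$ (i.e. $\pi=\pi^{-1}$ with an even number of inversions, an inversion being a pair $i<j$ with $\pi_i>\pi_j$) that avoid both $132$ and $\tau$ ($\pi$ avoids $\tau\in\mathfrak{S}_k$ if no subsequence $\pi_{i_1}\cdots\pi_{i_k}$, $i_1<\dots<i_k$, is order-isomorphic to $\tau$); $I^e_\tau(0)=1$ (empty involution). $12\cdots k$ denotes the identity pattern of length $k$. $U_r$ is the Chebyshev polynomial of the second kind: $U_r(\cos\theta)=\sin((r+1)\theta)/\sin\theta$, equivalently $U_0=1$, $U_1(t)=2t$, $U_r(t)=2tU_{r-1}(t)-U_{r-2}(t)$, and $U_{-1}=0$. For $k\geq0$, $R_k(x)=\dfrac{U_{k-1}\left(\frac{1}{2\sqrt{x}}\right)}{\sqrt{x}\,U_k\left(\frac{1}{2\sqrt{x}}\right)}$, a rational function of $x$ (so $R_0=0$, $R_1=1$, $R_2=1/(1-x)$, and $R_k=1/(1-xR_{k-1})$). $R^e_k(x)=\tfrac12(R_k(x)+R_k(-x))$.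 Both sides are regarded as power series in $x$. *)

(* Defs.v *)
From HB Require Import structures.
From mathcomp Require Import all_boot all_order all_fingroup all_algebra.

Set Implicit Arguments.
Unset Strict Implicit.
Unset Printing Implicit Defensive.

Import Order.TTheory GRing.Theory Num.Theory.

(* Permutations of {1, ..., n} are elements of 'S_n, with positions and values
   shifted to {0, ..., n - 1}. *)

Definition contains_pattern (n k : nat) (s : 'S_n) (tau : 'S_k) : bool :=
  [exists f : {ffun 'I_k -> 'I_n},
     [forall a : 'I_k, forall b : 'I_k, (a < b) ==> (f a < f b)] &&
     [forall a : 'I_k, forall b : 'I_k, (s (f a) < s (f b)) == (tau a < tau b)]].

Definition avoids (n k : nat) (s : 'S_n) (tau : 'S_k) : bool :=
  ~~ contains_pattern s tau.

Definition inversions (n : nat) (s : 'S_n) : nat :=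
  #|[set p : 'I_n * 'I_n | (p.1 < p.2) && (s p.2 < s p.1)]|.

Definition involution (n : nat) (s : 'S_n) : bool := s == (s^-1)%g.

Definition pat132 : 'S_3 := tperm (inord 1) (inord 2).

Definition idpat (k : nat) : 'S_k := 1%g.

Definition even_involutions (k : nat) (tau : 'S_k) (n : nat) : nat :=
  #|[set s : 'S_n | [&& involution s, ~~ odd (inversions s),
                        avoids s pat132 & avoids s tau]]|.

Local Open Scope ring_scope.

Fixpoint chebU (K : comNzRingType) (r : nat) : {poly K} :=
  match r with
  | 0 => 1
  | 1 => 2%:R *: 'X
  | (r'.+1 as r1).+1 => (2%:R *: 'X) * chebU K r1 - chebU K r'
  end.

(* U_(k-1), with the convention U_(-1) = 0. *)
Definition chebU_pred (K : comNzRingType) (k : nat) : {poly K} :=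
  if k is r.+1 then chebU K r else 0.

(* The formulas below are rational functions, written as total functions on an
   algebraically closed field C; at the finitely many points where a
   denominator vanishes their value is meaningless.  The value of Rk does not
   depend on the choice of the square root, because U_k has the parity of k. *)

Definition Rk (C : numClosedFieldType) (k : nat) (x : C) : C :=
  (chebU_pred C k).[1 / (2%:R * sqrtC x)] /
  (sqrtC x * (chebU C k).[1 / (2%:R * sqrtC x)]).

Definition Rk_even (C : numClosedFieldType) (k : nat) (x : C) : C :=
  1 / 2%:R * (Rk k x + Rk k (- x)).

Definition Fm (C : numClosedFieldType) (m : nat) (x : C) : C :=
  1 / (x * (chebU C m).[1 / (2%:R * x)]) *
  \sum_(0 <= j < m) (chebU C j).[1 / (2%:R * x)].

(* f is, away from finitely many points, a rational function P / Q regular at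
   0, and its power series at 0 is the sum of the a n * x ^+ n: the last clause
   is the identity Q * (\sum_n a n * x ^+ n) = P of formal power series. *)
Definition has_power_series (C : numClosedFieldType) (f : C -> C)
    (a : nat -> C) : Prop :=
  exists P Q : {poly C},
    [/\ Q.[0] != 0,
        exists bad : seq C, forall x, x \notin bad -> f x = P.[x] / Q.[x]
      & forall n, \sum_(i < n.+1) Q`_i * a (n - i)%N = P`_n].

(* Main.v *)
Require Import Defs.
From mathcomp Require Import all_boot all_order all_fingroup all_algebra.
From mathcomp Require Import zify ring.

Set Implicit Arguments.
Unset Strict Implicit.
Unset Printing Implicit Defensive.

Import Order.TTheory GRing.Theory Num.Theory.

(** A nonempty 132-avoiding permutation splits at its maximum as the skew sum
    (u (+) 1) (-) v, where u and v avoid 132; its longest increasing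
    subsequence has length max (lis u + 1, lis v).  Inversion reverses skew
    sums, so an involution of this shape either has v empty and u an
    involution, or is (u (+) 1) (-) m (-) (u (+) 1)^-1 with m an involution, in
    which case its number of inversions has the parity of that of m plus
    |u| + 1.  Writing N_k, A_k and E_k for the generating functions of the
    permutations, the involutions and the even involutions that avoid 132 and
    12...k, this gives
      N_(k+1)(x) (1 - x N_k(x)) = 1,
      A_(k+1)(x) (1 - x^2 N_k(x^2)) = 1 + x A_k(x),
      E_(k+1)(x) (1 + x^2 N_k(-x^2))
        = 1 + x E_k(x) + x^2 N^e_k(x^2) A_(k+1)(x).
    The rational functions R_k, F_k and the right-hand side of the theorem
    satisfy the same recurrences. *)

(** * Words *)

(** The first letter plays 1, and no later pair may play 32; [av132P] gives the subsequence form. *)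
Fixpoint av132 (w : seq nat) : bool :=
  if w is a :: w' then pairwise (fun b c => ~~ (a < c < b)) w' && av132 w'
  else true.

(** Only letters at least [lo] may be used; carrying this bound makes the recursion structural. *)
Fixpoint lis_from (lo : nat) (w : seq nat) : nat :=
  if w is a :: w' then
    maxn (lis_from lo w') (if lo <= a then (lis_from a.+1 w').+1 else 0)
  else 0.

Definition lis := lis_from 0.

Fixpoint inv_word (w : seq nat) : nat :=
  if w is a :: w' then count (fun b => b < a) w' + inv_word w' else 0.

Definition perm_word (w : seq nat) : bool := perm_eq w (iota 0 (size w)).

Definition good (w : seq nat) : bool := perm_word w && av132 w.

Definition skew_sum (u v : seq nat) : seq nat := [seq size v + x | x <- u] ++ v.

Definition winv (w : seq nat) : seq nat := [seq index i w | i <- iota 0 (size w)].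

(** * Statistics of concatenations *)

(** The last letter of an occurrence exceeds its first, so an occurrence that begins in [u] also
    ends there. *)
Lemma av132_cat u v :
  allrel (fun x y => y < x) u v -> av132 (u ++ v) = av132 u && av132 v.
Proof.
elim: u => //= a u IHu /andP[/allP av uv]; rewrite IHu // pairwise_cat.
have -> : allrel (fun b c => ~~ (a < c < b)) u v.
  by apply/allrelP => b c _ /av; lia.
rewrite (_ : pairwise _ v = true) /= ?andbT ?andbA //.
elim: v av {uv IHu} => //= b v IHv av; rewrite IHv ?andbT; last first.
  by move=> c cv; apply: av; rewrite inE cv orbT.
by apply/allP => c _; have := av b (mem_head _ _); lia.
Qed.

(** The last letter could only play 2, and nothing before it is large enough to play 3. *)
Lemma av132_rcons u n :
  all (fun x => x < n) u -> av132 (rcons u n) = av132 u.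
Proof.
elim: u => //= a u IHu /andP[an un]; rewrite IHu // pairwise_rcons.
rewrite (_ : all _ u = true) //; apply/allP => b /(allP un); lia.
Qed.

Lemma av132_shift b u : av132 [seq b + x | x <- u] = av132 u.
Proof.
elim: u => //= a u ->; rewrite pairwise_map; congr (_ && _).
by apply: eq_pairwise => x y /=; rewrite !ltn_add2l.
Qed.

Lemma lis_from_large lo v : all (fun y => y < lo) v -> lis_from lo v = 0.
Proof. by elim: v => //= a v IHv /andP[alo /IHv ->]; rewrite leqNgt alo. Qed.

(** No increasing subsequence can pass from [u] to [v]. *)
Lemma lis_from_cat lo u v :
  allrel (fun x y => y < x) u v ->
  lis_from lo (u ++ v) = maxn (lis_from lo u) (lis_from lo v).
Proof.
elim: u lo => [|a u IHu] lo /=; first by rewrite max0n.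
move=> /andP[av uv]; rewrite !IHu // (@lis_from_large a.+1 v); last first.
  by apply: sub_all av => y /=; lia.
by rewrite maxn0 maxnAC.
Qed.

Lemma lis_from_rcons lo u n : lo <= n -> all (fun x => x < n) u ->
  lis_from lo (rcons u n) = (lis_from lo u).+1.
Proof.
elim: u lo => [|a u IHu] lo lon /=; first by rewrite lon.
by move=> /andP[an un]; rewrite !IHu //; case: ifP; lia.
Qed.

Lemma lis_from_shift lo b u : lis_from lo [seq b + x | x <- u] = lis_from (lo - b) u.
Proof.
elim: u lo => //= a u IHu lo; rewrite !IHu leq_subLR.
by rewrite -addnS addKn.
Qed.

(** Every pair with one letter in each word is an inversion, whence the product. *)
Lemma inv_word_cat u v : allrel (fun x y => y < x) u v ->
  inv_word (u ++ v) = inv_word u + inv_word v + size u * size v.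
Proof.
elim: u => [|a u IHu] /=; first by rewrite addn0.
move=> /andP[av uv]; rewrite IHu // count_cat.
have /eqP -> : count (fun b => b < a) v == size v by rewrite -all_count.
by lia.
Qed.

Lemma inv_word_rcons u n : all (fun x => x < n) u ->
  inv_word (rcons u n) = inv_word u.
Proof.
elim: u => //= a u IHu /andP[an un]; rewrite IHu // -cats1 count_cat /=.
by rewrite ltnNge (ltnW an) /= !addn0.
Qed.

Lemma inv_word_shift b u : inv_word [seq b + x | x <- u] = inv_word u.
Proof.
elim: u => //= a u ->; rewrite count_map; congr (_ + _).
by apply: eq_count => x /=; rewrite ltn_add2l.
Qed.

(** * Permutation words and skew sums *)

Lemma mem_perm_word w x : perm_word w -> (x \in w) = (x < size w).
Proof. by move=> /perm_mem ->; rewrite mem_iota. Qed.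

Lemma perm_word_uniq w : perm_word w -> uniq w.
Proof. by move=> /perm_uniq ->; rewrite iota_uniq. Qed.

Lemma perm_word_lt w : perm_word w -> all (fun x => x < size w) w.
Proof. by move=> pw; apply/allP => x; rewrite mem_perm_word. Qed.

Lemma perm_word_rcons u : perm_word (rcons u (size u)) = perm_word u.
Proof.
rewrite /perm_word size_rcons -addn1 iotaD /= cats1 add0n.
by rewrite perm_rcons perm_sym perm_rcons perm_cons perm_sym.
Qed.

Lemma size_skew_sum u v : size (skew_sum u v) = size u + size v.
Proof. by rewrite size_cat size_map. Qed.

Lemma allrel_skew_sum u v : perm_word v ->
  allrel (fun x y => y < x) [seq size v + x | x <- u] v.
Proof.
move=> pv; apply/allrelP => x y /mapP[z _ ->].
by rewrite mem_perm_word //; lia.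
Qed.

Lemma iota_split m n : iota 0 (m + n) = iota 0 n ++ [seq n + x | x <- iota 0 m].
Proof. by rewrite addnC iotaD -iotaDl addn0. Qed.

Lemma perm_word_skew_sum u v :
  perm_word v -> perm_word (skew_sum u v) = perm_word u.
Proof.
move=> pv; rewrite /perm_word size_skew_sum iota_split /skew_sum.
have /permPr -> : perm_eq (iota 0 (size v) ++ [seq size v + x | x <- iota 0 (size u)])
   ([seq size v + x | x <- iota 0 (size u)] ++ v).
  by rewrite perm_sym perm_catC perm_cat2r.
rewrite perm_cat2r; apply/idP/idP; last exact: perm_map.
by apply: perm_map_inj; apply: addnI.
Qed.

Lemma av132_skew_sum u v :
  perm_word v -> av132 (skew_sum u v) = av132 u && av132 v.
Proof. by move=> pv; rewrite av132_cat ?av132_shift ?allrel_skew_sum. Qed.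

Lemma lis_skew_sum u v :
  perm_word v -> lis (skew_sum u v) = maxn (lis u) (lis v).
Proof. by move=> pv; rewrite /lis lis_from_cat ?lis_from_shift ?allrel_skew_sum. Qed.

Lemma inv_word_skew_sum u v : perm_word v ->
  inv_word (skew_sum u v) = inv_word u + inv_word v + size u * size v.
Proof.
by move=> pv; rewrite inv_word_cat ?inv_word_shift ?allrel_skew_sum ?size_map.
Qed.

Lemma good_skew_sum u v : good v -> good (skew_sum u v) = good u.
Proof.
by case/andP=> pv av; rewrite /good perm_word_skew_sum // av132_skew_sum // av andbT.
Qed.

Lemma good_rcons u : good (rcons u (size u)) = good u.
Proof.
rewrite /good perm_word_rcons; case pu: (perm_word u) => //=.
by rewrite av132_rcons // perm_word_lt.
Qed.

Lemma lis_rcons u : perm_word u -> lis (rcons u (size u)) = (lis u).+1.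
Proof. by move=> pu; rewrite /lis lis_from_rcons // perm_word_lt. Qed.

Lemma inv_word_rcons_size u :
  perm_word u -> inv_word (rcons u (size u)) = inv_word u.
Proof. by move=> pu; rewrite inv_word_rcons // perm_word_lt. Qed.

Lemma skew_sumA u v w : skew_sum u (skew_sum v w) = skew_sum (skew_sum u v) w.
Proof.
rewrite /skew_sum map_cat -map_comp -catA size_cat size_map.
by congr (_ ++ _); apply: eq_map => x /=; lia.
Qed.

Lemma skew_sum_inj u v u' v' : size u = size u' ->
  skew_sum u v = skew_sum u' v' -> u = u' /\ v = v'.
Proof.
move=> suu' /eqP; rewrite eqseq_cat ?size_map // => /andP[/eqP + /eqP vv'].
by rewrite vv' => /inj_map ->; last exact: addnI.
Qed.

Lemma skew_sum_injl u v u' : skew_sum u v = skew_sum u' v -> u = u'.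
Proof.
move=> E; have := congr1 size E; rewrite !size_skew_sum => /addIn su.
by case: (skew_sum_inj su E).
Qed.

(** * Inverse words *)

Lemma size_winv w : size (winv w) = size w.
Proof. by rewrite size_map size_iota. Qed.

(** Values below [size v] sit after the [size u] letters of the first block, so they form the
    leading, lifted block of the inverse. *)
Lemma winv_skew_sum u v : perm_word u -> perm_word v ->
  winv (skew_sum u v) = skew_sum (winv v) (winv u).
Proof.
move=> pu pv; rewrite /winv size_skew_sum iota_split map_cat /skew_sum -!map_comp.
rewrite size_map size_iota; congr (_ ++ _).
  apply/eq_in_map => i; rewrite mem_iota /= => iv; rewrite index_cat size_map.
  by case: mapP => // -[x _ ix]; lia.
apply/eq_in_map => i; rewrite mem_iota /= => iu; rewrite index_cat.
rewrite mem_map; last exact: addnI.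
by rewrite mem_perm_word // iu index_map //; apply: addnI.
Qed.

Lemma winv_rcons u :
  perm_word u -> winv (rcons u (size u)) = rcons (winv u) (size u).
Proof.
move=> pu; rewrite /winv size_rcons -addn1 iotaD map_cat -!cats1 /=.
rewrite index_cat mem_perm_word // ltnn /= eqxx addn0; congr (_ ++ _).
apply/eq_in_map => i; rewrite mem_iota /= => iu.
by rewrite index_cat mem_perm_word // iu.
Qed.

(** * Decomposition at the maximum *)

Lemma perm_word_unshift b w : perm_eq w (iota b (size w)) ->
  exists2 u, perm_word u & w = [seq b + x | x <- u].
Proof.
move=> pw; exists [seq x - b | x <- w].
  rewrite /perm_word size_map; have := perm_map (subn^~ b) pw.
  rewrite -[X in iota X _](addn0 b) iotaDl -map_comp => /permPl ->.
  by rewrite map_id_in // => x _ /=; rewrite addKn.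
rewrite -map_comp map_id_in // => x; rewrite (perm_mem pw) mem_iota /=.
by move=> /andP[bx _]; rewrite subnKC.
Qed.

(** Sorted [V] followed by sorted [U] is a sorted rearrangement of 0, ..., n - 1; cutting it after
    [size V] entries gives the values in each block. *)
Lemma perm_word_cat U V : allrel (fun x y => y < x) U V -> perm_word (U ++ V) ->
  perm_word V /\ exists2 u, perm_word u & U = [seq size V + x | x <- u].
Proof.
move=> UV pUV.
have E : sort leq V ++ sort leq U = iota 0 (size V + size U).
  apply: (sorted_eq leq_trans anti_leq); last 1 first.
  - rewrite addnC -size_cat (perm_trans _ pUV) // perm_sym.
    rewrite (perm_trans (permEl (perm_catC _ _))) //.
    by rewrite perm_sym; apply: perm_cat; rewrite perm_sort.
  - have tr : {in V ++ U & &, transitive leq} by move=> *; apply: leq_trans; eassumption.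
    rewrite sorted_pairwise; last exact: leq_trans.
    rewrite pairwise_cat -!sorted_pairwise; try exact: leq_trans.
    rewrite !sort_sorted ?andbT; try exact: leq_total.
    apply/allrelP => x y; rewrite !mem_sort => xV yU.
    by move/allrelP: UV => /(_ _ _ yU xV); lia.
  - exact: iota_sorted.
move/eqP: E; rewrite iotaD eqseq_cat ?size_sort ?size_iota // => /andP[/eqP EV /eqP EU].
split; first by rewrite /perm_word -EV perm_sym perm_sort.
by apply: perm_word_unshift; rewrite -[X in iota X _]add0n -EU perm_sym perm_sort.
Qed.

(** A letter before the maximum [n] and a larger one after it would form 132 with [n] in the middle;
    hence all letters before [n] exceed all those after it. *)
Lemma good_decomp n w : good w -> size w = n.+1 ->
  exists u v, [/\ good u, good v, size u = index n w, size v = n - index n w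
    & w = skew_sum (rcons u (size u)) v].
Proof.
move=> gw sw; case/andP: (gw) => pw aw.
have nw : n \in w by rewrite mem_perm_word // sw.
have uw := perm_word_uniq pw.
have : index n w <= n by rewrite -ltnS -sw index_mem.
case/splitPr: nw gw pw aw uw sw => U V gw pw aw uw sw.
have nU : n \notin U by move: uw; rewrite cat_uniq /=; case: (n \in U); rewrite ?andbF.
rewrite index_cat (negbTE nU) /= eqxx addn0 => Un.
have lt x : x \in U ++ n :: V -> x <= n by rewrite mem_perm_word // sw ltnS.
have UV : allrel (fun x y => y < x) (rcons U n) V.
  rewrite -cats1 allrel_catl allrel1l; apply/andP; split; last first.
    apply/allP => y yV; have := lt y; rewrite mem_cat inE yV !orbT => /(_ isT).
    rewrite leq_eqVlt => /predU1P[yn|//].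
    by move: uw; rewrite cat_uniq /= -yn yV /= !andbF.
  elim: U aw uw nU {gw pw sw Un lt} (lt) => //= a U IHU.
  rewrite pairwise_cat /= => /andP[/and4P[_ _ /allP aV _] aw].
  rewrite mem_cat !inE => /andP[/norP[aU /norP[an' aV']] uw] /norP[an nU] lt.
  rewrite allrel_consl IHU //; last first.
    by move=> x xUV; apply: lt; rewrite inE xUV orbT.
  rewrite andbT; apply/allP => y yV.
  have := aV _ yV; have := lt y; rewrite inE mem_cat inE yV !orbT => /(_ isT) yn.
  have : y != a by apply: contraNneq aV' => <-.
  have : y != n.
    by move: uw; rewrite cat_uniq /= => /and4P[_ _ nV _]; apply: contraNneq nV => <-.
  by lia.
have pUV : perm_word (rcons U n ++ V) by rewrite cat_rcons.
have [pV [u]] := perm_word_cat UV pUV.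
case/lastP: u => [|u x]; first by case: (U).
rewrite map_rcons => pu /rcons_inj[EU En].
have sU : size U = size u by rewrite EU size_map.
(* Comparing the length of the word with the value of [n] shows that the standardised block ends
   with its maximum. *)
have ux : x = size u.
  move: sw; rewrite size_cat /= addnS sU => -[].
  by rewrite En addnC => /addnI.
have Ew : U ++ n :: V = skew_sum (rcons u (size u)) V.
  by rewrite /skew_sum map_rcons cat_rcons -EU -ux En.
subst x; have gV : good V.
  rewrite /good pV /=; case/andP: gw => _; rewrite Ew av132_skew_sum //.
  by case/andP.
exists u, V; split => //.
  by rewrite -good_rcons -(good_skew_sum _ gV) -Ew.
by move: sw; rewrite size_cat /=; lia.
Qed.

(** Both parts of the decomposition are shorter than the word, so it supports a structural
    induction. *)
Lemma good_ind (P : seq nat -> Prop) : P [::] ->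
  (forall u v, good u -> good v -> P u -> P v ->
     P (skew_sum (rcons u (size u)) v)) ->
  forall w, good w -> P w.
Proof.
move=> P0 PS w; have [n] := ubnP (size w); elim: n w => // n IHn w swn gw.
case sw: (size w) => [|m]; first by move/size0nil: sw => ->.
have [u [v [gu gv su sv Ew]]] := good_decomp gw sw.
have swE : size w = (size u).+1 + size v by rewrite Ew size_skew_sum size_rcons.
by rewrite {1}Ew; apply: PS => //; apply: IHn => //; lia.
Qed.

(** Inversion exchanges the two blocks of the decomposition, and both statistics are symmetric in
    the blocks. *)
Lemma winv_good w : good w ->
  [/\ good (winv w), winv (winv w) = w, lis (winv w) = lis w
    & inv_word (winv w) = inv_word w].
Proof.
move: w; apply: good_ind => // u v gu gv [giu iiu liu niu] [giv iiv liv niv].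
have [/andP[pu _] /andP[pv _]] := (gu, gv).
have [/andP[piu _] /andP[piv _]] := (giu, giv).
have pr : perm_word (rcons u (size u)) by rewrite perm_word_rcons.
have pri : perm_word (rcons (winv u) (size (winv u))) by rewrite perm_word_rcons.
rewrite winv_skew_sum // winv_rcons // -(size_winv u).
rewrite good_skew_sum ?good_rcons // winv_skew_sum // winv_rcons // iiu iiv.
rewrite !lis_skew_sum // !lis_rcons // !inv_word_skew_sum // !inv_word_rcons_size //.
rewrite size_winv lis_rcons // inv_word_rcons_size //; split => //.
  by rewrite maxnC liu liv.
by rewrite !size_rcons !size_winv niu niv mulnC [inv_word v + _]addnC.
Qed.

Lemma good_rcons_winv u : good u ->
  [/\ good (rcons u (size u)), good (winv (rcons u (size u))) &
    winv (rcons u (size u)) = rcons (winv u) (size u)].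
Proof.
move=> gu; have gr : good (rcons u (size u)) by rewrite good_rcons.
by split => //; [case: (winv_good gr) | rewrite winv_rcons; case/andP: gu].
Qed.

(** * Shape of the involutions *)

Definition invol_word (u m : seq nat) : seq nat :=
  skew_sum (rcons u (size u)) (skew_sum m (winv (rcons u (size u)))).

Lemma good_invol_word u m : good u -> good m -> good (invol_word u m).
Proof.
move=> gu gm; have [gr gi _] := good_rcons_winv gu.
by rewrite good_skew_sum // good_skew_sum.
Qed.

(** Reversing the order of the blocks and inverting each restores the outer two, so only the middle
    one changes. *)
Lemma winv_invol_word u m : good u -> good m ->
  winv (invol_word u m) = invol_word u (winv m).
Proof.
move=> gu gm; have [gr gi _] := good_rcons_winv gu.
have gv : good (skew_sum m (winv (rcons u (size u)))) by rewrite good_skew_sum.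
have [/andP[pr _] /andP[pi _]] := (gr, gi).
have [/andP[pm _] /andP[pv _]] := (gm, gv).
rewrite /invol_word !winv_skew_sum //; case: (winv_good gr) => _ -> _ _.
by rewrite skew_sumA.
Qed.

Lemma invol_word_inj u m u' m' : size u = size u' ->
  invol_word u m = invol_word u' m' -> u = u' /\ m = m'.
Proof.
move=> su /skew_sum_inj[]; first by rewrite !size_rcons su.
by move=> /rcons_inj[<- _] /skew_sum_injl.
Qed.

(** [w] has two skew decompositions, the given one and the one coming from its inverse; comparing
    them shows that [v] ends with the inverse of the first block. *)
Lemma invol_decomp u v : good u -> good v -> v != [::] ->
  let w := skew_sum (rcons u (size u)) v in winv w = w ->
  exists m, [/\ good m, winv m = m & w = invol_word u m].
Proof.
move=> gu gv vn0 w Ew; have [gr gi Ei] := good_rcons_winv gu.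
have [/andP[pr _] /andP[pi _]] := (gr, gi); have /andP[pv _] := gv.
have Ew' : skew_sum (winv v) (winv (rcons u (size u))) = w.
  by rewrite -winv_skew_sum.
(* The inverse ends with the letter [size u], while [w] ends with a letter of the nonempty [v]. *)
have ltuv : size u < size v.
  have := congr1 (last 0) Ew'; rewrite Ei /w /skew_sum !last_cat last_rcons => ->.
  case: (v) vn0 pv => // a v' _ pv; rewrite -mem_perm_word //.
  by rewrite /= mem_last.
have Ev : v = take (size v - (size u).+1) v ++ winv (rcons u (size u)).
  rewrite -{1}(cat_take_drop (size v - (size u).+1) v); congr (_ ++ _).
  have := congr1 (drop (size v)) Ew'.
  rewrite /skew_sum drop_size_cat ?size_map ?size_iota // => ->.
  by rewrite drop_cat size_map size_rcons ltnNge ltuv.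
set m' := take _ _ in Ev.
(* The suffix of [v] takes the values 0, ..., [size u], so those of [m'] start at [(size u).+1]. *)
have [] := @perm_word_unshift (size u).+1 m'.
  move: pv; rewrite /perm_word Ev size_cat iota_split size_winv size_rcons.
  have /permPr -> : perm_eq
    (iota 0 (size u).+1 ++ [seq (size u).+1 + x | x <- iota 0 (size m')])
    ([seq (size u).+1 + x | x <- iota 0 (size m')] ++ winv (rcons u (size u))).
    rewrite perm_sym perm_catC perm_cat2r perm_sym.
    by move: pi; rewrite /perm_word size_winv size_rcons perm_sym.
  by rewrite perm_cat2r -iotaDl addn0.
move=> m pm Em; have Evm : v = skew_sum m (winv (rcons u (size u))).
  by rewrite {1}Ev Em /skew_sum size_winv size_rcons.
have gm : good m by move: gv; rewrite Evm good_skew_sum.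
exists m; split => //; last by rewrite /w Evm.
(* Inverting [w] inverts only the middle block; since [w] is fixed, cancelling the outer blocks
   gives [winv m = m]. *)
have := winv_invol_word gu gm; rewrite /invol_word -Evm -/w Ew /w Evm.
by move/skew_sum_inj => /(_ erefl)[_] /skew_sum_injl.
Qed.

(** * Fibers over the position of the maximum *)

Definition good_words (n : nat) : seq (seq nat) :=
  [seq w <- permutations (iota 0 n) | av132 w].

Definition invol_words (n : nat) : seq (seq nat) :=
  [seq w <- good_words n | winv w == w].

Lemma mem_good_words n w : (w \in good_words n) = good w && (size w == n).
Proof.
rewrite mem_filter mem_permutations /good /perm_word.
apply/andP/andP => [[aw pw]|[/andP[pw aw] /eqP sw]]; last by rewrite -sw.
by have := perm_size pw; rewrite size_iota => sw; rewrite sw pw aw eqxx.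
Qed.

Lemma uniq_good_words n : uniq (good_words n).
Proof. by rewrite filter_uniq // permutations_uniq. Qed.

Lemma mem_invol_words n w :
  (w \in invol_words n) = [&& good w, winv w == w & size w == n].
Proof. by rewrite mem_filter mem_good_words andbCA. Qed.

Lemma uniq_invol_words n : uniq (invol_words n).
Proof. by rewrite filter_uniq // uniq_good_words. Qed.

Lemma index_skew_sum u v n : perm_word u -> perm_word v ->
  size u + size v = n -> index n (skew_sum (rcons u (size u)) v) = size u.
Proof.
move=> pu pv <-; rewrite index_cat map_rcons mem_rcons addnC mem_head.
rewrite -map_rcons index_map; last exact: addnI.
by rewrite -cats1 index_cat mem_perm_word // ltnn /= eqxx addn0.
Qed.

(** [good_decomp] reaches every word, and as the block lengths are fixed, [skew_sum_inj] excludes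
    repetitions. *)
Lemma good_words_fiber n i : i <= n ->
  perm_eq [seq w <- good_words n.+1 | index n w == i]
    [seq skew_sum (rcons u i) v | u <- good_words i, v <- good_words (n - i)].
Proof.
move=> lein; apply: uniq_perm.
- by rewrite filter_uniq // uniq_good_words.
- apply: allpairs_uniq => [||[u v] [u' v']]; try exact: uniq_good_words.
  move=> /allpairsP[[x y] [xg yg [-> ->]]] /allpairsP[[x' y'] [xg' yg' [-> ->]]] /=.
  move: xg xg'; rewrite !mem_good_words => /andP[_ /eqP sx] /andP[_ /eqP sx'].
  case/skew_sum_inj; first by rewrite !size_rcons sx sx'.
  by move=> /rcons_inj[->] ->.
move=> w; rewrite mem_filter mem_good_words; apply/idP/allpairsP.
  move=> /and3P[/eqP iw gw /eqP sw].
  have [u [v [gu gv su sv ->]]] := good_decomp gw sw.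
  exists (u, v); rewrite !mem_good_words su sv iw !eqxx gu gv /=.
  by split => //; rewrite -{1}iw -su.
case=> -[u v]; rewrite !mem_good_words /= => -[/andP[gu /eqP su] /andP[gv /eqP sv] ->].
have [/andP[pu _] /andP[pv _]] := (gu, gv).
rewrite -su index_skew_sum ?eqxx // ?su ?sv ?subnKC //=.
rewrite -su good_skew_sum // good_rcons gu size_skew_sum size_rcons sv su.
by rewrite addSn subnKC //=.
Qed.

(** A maximum in last place leaves [v] empty, and it is a fixed point that can be removed. *)
Lemma invol_words_fiber_max n :
  perm_eq [seq w <- invol_words n.+1 | index n w == n]
    [seq rcons u n | u <- invol_words n].
Proof.
have skew0 u : skew_sum u [::] = u by rewrite /skew_sum cats0 map_id_in.
apply: uniq_perm.
- by rewrite filter_uniq // uniq_invol_words.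
- by rewrite map_inj_uniq ?uniq_invol_words // => x y /rcons_inj[].
move=> w; rewrite mem_filter mem_invol_words; apply/idP/mapP.
  move=> /and4P[/eqP iw gw /eqP ww /eqP sw].
  have [u [v [gu gv su]]] := good_decomp gw sw.
  rewrite iw subnn => /size0nil -> ; rewrite skew0 => Ew.
  exists u; last by rewrite Ew su iw.
  rewrite mem_invol_words su iw gu eqxx andbT /=.
  move: ww; rewrite Ew winv_rcons; last by case/andP: gu.
  by move/rcons_inj => [->].
case=> u; rewrite mem_invol_words => /and3P[gu /eqP wu /eqP su] ->.
have /andP[pu _] := gu.
rewrite -su winv_rcons // wu good_rcons gu size_rcons !eqxx !andbT.
by rewrite -cats1 index_cat mem_perm_word // ltnn /= eqxx addn0.
Qed.

(** Here [v] is nonempty and [invol_decomp] applies; the outer blocks have length [i.+1] each, and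
    the fiber is empty when they do not fit. *)
Lemma invol_words_fiber n i : i < n ->
  perm_eq [seq w <- invol_words n.+1 | index n w == i]
    (if i.+1.*2 <= n.+1 then
      [seq invol_word u m | u <- good_words i, m <- invol_words (n.+1 - i.+1.*2)]
     else [::]).
Proof.
move=> ltin; apply: uniq_perm.
- by rewrite filter_uniq // uniq_invol_words.
- case: ifP => // _; apply: allpairs_uniq => [||[u v] [u' v']].
  + exact: uniq_good_words.
  + exact: uniq_invol_words.
  move=> /allpairsP[[x y] [xg yg [-> ->]]] /allpairsP[[x' y'] [xg' yg' [-> ->]]] /=.
  move: xg xg'; rewrite !mem_good_words => /andP[_ /eqP sx] /andP[_ /eqP sx'].
  by case/invol_word_inj; rewrite ?sx ?sx' // => -> ->.
move=> w; rewrite mem_filter mem_invol_words.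
have sz u m : size (invol_word u m) = (size u).+1.*2 + size m.
  by rewrite !size_skew_sum size_winv size_rcons; lia.
apply/idP/idP.
  move=> /and4P[/eqP iw gw /eqP ww /eqP sw].
  have [u [v [gu gv su sv Ew]]] := good_decomp gw sw.
  have vn0 : v != [::] by rewrite -size_eq0 sv iw; lia.
  have [|m [gm wm Em]] := invol_decomp gu gv vn0; first by rewrite -Ew.
  have := sw; rewrite Ew Em sz su iw => sm.
  rewrite -sm leq_addr; apply/allpairsP; exists (u, m).
  by rewrite /= mem_good_words mem_invol_words gu gm wm su iw !eqxx addKn eqxx.
case: ifP => // le2; case/allpairsP => -[u m] /=; rewrite mem_good_words mem_invol_words.
move=> [/andP[gu /eqP su] /and3P[gm /eqP wm /eqP sm] ->].
rewrite good_invol_word // winv_invol_word // wm sz su sm subnKC // !eqxx !andbT.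
have [gr gi _] := good_rcons_winv gu.
have [/andP[pu _] /andP[pi _] /andP[pm _]] := And3 gu gi gm.
rewrite /invol_word index_skew_sum ?su ?eqxx //.
  by rewrite -su perm_word_skew_sum.
by rewrite size_skew_sum sm size_winv size_rcons su; lia.
Qed.

(** * Recurrences for the counts *)

Lemma count_fibers (T : Type) (P : pred T) (f : T -> nat) (s : seq T) n :
  all (fun x => f x < n) s ->
  count P s = \sum_(0 <= i < n) count P [seq x <- s | f x == i].
Proof.
elim: s => [_|x s IHs /= /andP[fx /IHs ->]] /=; first by rewrite big1_eq.
rewrite (bigD1_seq (f x)) ?mem_index_iota ?iota_uniq //=.
rewrite [RHS](bigD1_seq (f x)) /=; last 2 first.
- by rewrite mem_index_iota.
- by rewrite iota_uniq.
rewrite eqxx /= addnA; congr (_ + _); apply: eq_bigr => i.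
by rewrite eq_sym => /negbTE ->.
Qed.

Lemma count_allpairs (S T U : eqType) (P : pred U) (P1 : pred S) (P2 : pred T)
    (f : S -> T -> U) s t :
  {in s & t, forall x y, P (f x y) = P1 x && P2 y} ->
  count P [seq f x y | x <- s, y <- t] = count P1 s * count P2 t.
Proof.
elim: s => //= x s IHs Pf; rewrite count_cat IHs => [|y z ys zt]; last first.
  by apply: Pf => //; rewrite inE ys orbT.
rewrite mulnDl; congr (_ + _); rewrite count_map.
rewrite (eq_in_count (a2 := fun y => P1 x && P2 y)) => [|y yt]; last first.
  by apply: Pf; rewrite ?mem_head.
by case: (P1 x); rewrite ?mul1n ?mul0n //= count_pred0.
Qed.

Definition avoiders (k n : nat) : nat :=
  count (fun w => lis w < k) (good_words n).

(** Both parities are kept because the recurrence for one involves the other. *)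
Definition invol_avoiders (b : bool) (k n : nat) : nat :=
  count (fun w => (lis w < k) && (odd (inv_word w) == b)) (invol_words n).

(** The coefficient form of N_(k+1) = 1 + x N_k N_(k+1); the index drops for the letters before the
    maximum, as it extends their increasing subsequences. *)
Lemma avoidersS k n :
  avoiders k.+1 n.+1 = \sum_(0 <= i < n.+1) avoiders k i * avoiders k.+1 (n - i).
Proof.
rewrite /avoiders (@count_fibers _ _ (index n) _ n.+1); last first.
  apply/allP => w; rewrite mem_good_words => /andP[/andP[pw _] /eqP sw].
  by rewrite -sw index_mem mem_perm_word // sw.
apply: eq_big_nat => i /andP[_ lein].
rewrite (seq.permP (good_words_fiber _)) //; apply: count_allpairs => u v.
rewrite !mem_good_words => /andP[/andP[pu _] /eqP <-] /andP[/andP[pv _] _].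
by rewrite lis_skew_sum // lis_rcons // gtn_max.
Qed.

Lemma lis_invol_word u m : good u -> good m ->
  lis (invol_word u m) = maxn (lis u).+1 (lis m).
Proof.
move=> gu gm; have [gr gi _] := good_rcons_winv gu.
have gv : good (skew_sum m (winv (rcons u (size u)))) by rewrite good_skew_sum.
have [/andP[pv _] /andP[pi _] /andP[pu _]] := And3 gv gi gu.
rewrite !lis_skew_sum //; case: (winv_good gr) => _ _ -> _.
by rewrite lis_rcons // maxnCA maxnn maxnC.
Qed.

(** The outer blocks have equally many inversions, and pairs between [m] and them come in two equal
    numbers; modulo 2, the outer blocks against each other leave (|u| + 1)^2. *)
Lemma odd_inv_invol_word u m : good u -> good m ->
  odd (inv_word (invol_word u m)) = odd (inv_word m) (+) ~~ odd (size u).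
Proof.
move=> gu gm; have [gr gi _] := good_rcons_winv gu.
have gv : good (skew_sum m (winv (rcons u (size u)))) by rewrite good_skew_sum.
have [/andP[pv _] /andP[pi _] /andP[pu _]] := And3 gv gi gu.
rewrite !inv_word_skew_sum //; case: (winv_good gr) => _ _ _ ->.
rewrite size_skew_sum size_winv size_rcons !oddD !oddM /= oddD /=.
by case: (odd _); case: (odd _); case: (odd _); case: (odd _).
Qed.

(** The first term is the fiber with the maximum last; in the others, outer blocks of length [i.+1]
    shift the parity by i + 1. *)
Lemma invol_avoidersS b k n :
  invol_avoiders b k.+1 n.+1 = invol_avoiders b k n +
    \sum_(0 <= i < n | i.+1.*2 <= n.+1)
      avoiders k i * invol_avoiders (b (+) ~~ odd i) k.+1 (n.+1 - i.+1.*2).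
Proof.
rewrite {1}/invol_avoiders (@count_fibers _ _ (index n) _ n.+1); last first.
  apply/allP => w; rewrite mem_invol_words => /and3P[/andP[pw _] _ /eqP sw].
  by rewrite -sw index_mem mem_perm_word // sw.
rewrite big_nat_recr //= addnC; congr (_ + _).
  rewrite (seq.permP (invol_words_fiber_max _)) count_map; apply: eq_in_count => u.
  rewrite mem_invol_words => /and3P[/andP[pu _] _ /eqP <-] /=.
  by rewrite lis_rcons // inv_word_rcons_size.
rewrite [RHS]big_mkcond /=; apply: eq_big_nat => i /andP[_ ltin].
rewrite (seq.permP (invol_words_fiber ltin)); case: ifP => // _.
apply: count_allpairs => u m.
rewrite mem_good_words mem_invol_words => /andP[gu /eqP <-] /and3P[gm _ _].
rewrite lis_invol_word // odd_inv_invol_word // gtn_max ltnS -andbA; congr [&& _, _ & _].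
by case: (odd _); case: (odd _); case: b.
Qed.

Lemma avoiders0 n : avoiders 0 n = 0.
Proof. exact: count_pred0. Qed.

Lemma invol_avoiders0 b n : invol_avoiders b 0 n = 0.
Proof. exact: count_pred0. Qed.

Lemma invol_avoidersS0 b k : invol_avoiders b k.+1 0 = ~~ b.
Proof. by case: b. Qed.

(** * Words of permutations *)

Definition word (n : nat) (s : 'S_n) : seq nat := [seq val (s i) | i <- enum 'I_n].

Lemma size_word n (s : 'S_n) : size (word s) = n.
Proof. by rewrite size_map size_enum_ord. Qed.

Lemma nth_word n (s : 'S_n) (i : 'I_n) : nth 0 (word s) i = s i.
Proof. by rewrite (nth_map i) ?size_enum_ord // nth_ord_enum. Qed.

Lemma perm_word_word n (s : 'S_n) : perm_word (word s).
Proof.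
rewrite /perm_word size_word -val_enum_ord /word (map_comp val s).
apply: perm_map; apply: uniq_perm; rewrite ?enum_uniq //.
  by rewrite map_inj_uniq ?enum_uniq //; apply: perm_inj.
move=> i; rewrite mem_enum; apply/mapP; exists (s^-1%g i); rewrite ?mem_enum //.
by rewrite permKV.
Qed.

Lemma word_inj n : injective (@word n).
Proof.
move=> s t E; apply/permP => i; apply: val_inj.
by rewrite /= -!nth_word E.
Qed.

Lemma word_surj n w : perm_word w -> size w = n -> exists s : 'S_n, word s = w.
Proof.
move=> pw sw; have ltw (i : 'I_n) : nth 0 w i < n.
  by rewrite -{2}sw -mem_perm_word // mem_nth // sw.
pose f i := Ordinal (ltw i).
have f_inj : injective f.
  move=> i j [] /eqP; rewrite nth_uniq ?sw ?perm_word_uniq // => /eqP.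
  exact: val_inj.
exists (perm f_inj); apply: (@eq_from_nth _ 0); rewrite size_word // => i ltin.
by rewrite (nth_word _ (Ordinal ltin)) permE.
Qed.

Lemma winv_word n (s : 'S_n) : winv (word s) = word s^-1%g.
Proof.
rewrite /winv size_word -val_enum_ord /word -map_comp; apply: eq_map => i /=.
have -> : [seq val (s j) | j <- enum 'I_n] = [seq val j | j <- [seq s j | j <- enum 'I_n]].
  exact: (map_comp val s).
rewrite index_map; last exact: val_inj.
by rewrite -{1}(permKV s i) index_map ?index_enum_ord //; apply: perm_inj.
Qed.

Lemma involution_word n (s : 'S_n) : involution s = (winv (word s) == word s).
Proof. by rewrite winv_word (inj_eq (@word_inj n)) eq_sym. Qed.

(** * Pattern containment and inversions read on words *)

Lemma sorted_enum_ord n : sorted (fun i j : 'I_n => i < j) (enum 'I_n).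
Proof. by have := iota_ltn_sorted 0 n; rewrite -val_enum_ord sorted_map. Qed.

Lemma subseq_enum_ord n (e : seq 'I_n) :
  sorted (fun i j : 'I_n => i < j) e -> subseq e (enum 'I_n).
Proof.
have tr : transitive (fun i j : 'I_n => i < j) by move=> j i l; apply: ltn_trans.
move=> se; apply/subseq_uniqP; first exact: enum_uniq.
have irr : irreflexive (fun i j : 'I_n => i < j) by move=> i; apply: ltnn.
apply: (irr_sorted_eq tr irr se).
  apply: sorted_filter => //; exact: sorted_enum_ord.
by move=> i; rewrite mem_filter mem_enum andbT.
Qed.

(** Increasing choices of positions are sublists of [enum 'I_n], and their values form the
    subsequences of the word. *)
Lemma contains_patternP n k (s : 'S_n) (tau : 'S_k) :
  reflect (exists t, [/\ subseq t (word s), size t = k &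
             forall a b : 'I_k, (nth 0 t a < nth 0 t b) = (tau a < tau b)])
          (contains_pattern s tau).
Proof.
apply: (iffP existsP) => [[f /andP[/forallP incf /forallP ordf]]|[t [st zt ordt]]].
  exists [seq val (s (f a)) | a <- enum 'I_k]; split.
  - rewrite (map_comp (fun i => val (s i)) f); apply: map_subseq.
    apply: subseq_enum_ord; rewrite sorted_map.
    apply: (@sub_sorted _ (fun a b : 'I_k => a < b)).
      by move=> a b ab; have /forallP/(_ b)/implyP := incf a; apply.
    exact: sorted_enum_ord.
  - by rewrite size_map size_enum_ord.
  have nthE (a : 'I_k) : nth 0 [seq val (s (f a)) | a <- enum 'I_k] a = s (f a).
    by rewrite (nth_map a) ?size_enum_ord // nth_ord_enum.
  move=> a b; rewrite !nthE.
  by have /forallP/(_ b)/eqP := ordf a.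
(* The mask that cuts out the values, applied to the positions, gives the embedding. *)
have [m zm Et] := subseqP st; rewrite /word -map_mask in Et.
set e := mask m _ in Et.
have ze : size e == k by rewrite -zt Et size_map.
have se : sorted (fun i j : 'I_n => i < j) e.
  apply: (@subseq_sorted _ _ _ _ (enum 'I_n)) => //.
  - by move=> j i l; apply: ltn_trans.
  - exact: mask_subseq.
  - exact: sorted_enum_ord.
have tr : transitive (fun i j : 'I_n => i < j) by move=> j i l; apply: ltn_trans.
exists [ffun a => tnth (Tuple ze) a]; apply/andP; split.
  apply/forallP => a; apply/forallP => b; apply/implyP => ab; rewrite !ffunE.
  have x0 := tnth (Tuple ze) a; rewrite !(tnth_nth x0) /=.
  by apply: (sorted_ltn_nth tr) => //; rewrite inE (eqP ze).
apply/forallP => a; apply/forallP => b; rewrite !ffunE -ordt.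
have x0 := tnth (Tuple ze) a.
by rewrite Et !(nth_map x0) ?(eqP ze) // !(tnth_nth x0) /=.
Qed.

(** A witness either skips [a] or begins with it, and then its other letters are at least [a.+1]. *)
Lemma leq_lis_fromP k lo w :
  reflect (exists t, [/\ subseq t w, sorted ltn t, all (leq lo) t & size t = k])
          (k <= lis_from lo w).
Proof.
elim: w k lo => [|a w IHw] k lo /=.
  apply: (iffP idP) => [|[t [/eqP -> _ _ <-//]]].
  by rewrite leqn0 => /eqP ->; exists [::].
rewrite leq_max; apply: (iffP orP) => [[/IHw[t [tw st at' zt]]|]|].
- by exists t; split => //; apply: subseq_trans tw (subseq_cons _ _).
- case: ifP => [loa|_]; last by rewrite leqn0 => /eqP ->; exists [::].
  case: k => [|k]; first by exists [::].
  rewrite ltnS => /IHw[t [tw st at' zt]]; exists (a :: t).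
  rewrite /= eqxx loa zt path_sortedE; last exact: ltn_trans.
  rewrite st (_ : all (ltn a) t) //; split => //.
  by apply: sub_all at' => x; apply: leq_trans; rewrite ltnW.
case=> -[|x t] [tw st at' zt].
  by left; rewrite -zt.
move: tw st at' zt; rewrite /=.
rewrite path_sortedE; last exact: ltn_trans.
case: eqP => [-> tw /andP[xt st] /andP[loa at'] <-|_ tw st at' zt].
  right; rewrite loa ltnS; apply/IHw; exists t; split => //.
left; apply/IHw; exists (x :: t); split => //=.
by rewrite path_sortedE //; apply: ltn_trans.
Qed.

Lemma avoids_idpat n k (s : 'S_n) : avoids s (idpat k) = (lis (word s) < k).
Proof.
rewrite /avoids ltnNge; congr negb; apply/contains_patternP/leq_lis_fromP.
  case=> t [tw zt ordt]; exists t; split => //; last by apply/allP.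
  apply/(sortedP 0) => i; rewrite zt => lti.
  have := ordt (Ordinal (ltnW lti)) (Ordinal lti).
  by rewrite !perm1 /= ltnSn => ->.
case=> t [tw st _ zt]; exists t; split => // a b; rewrite !perm1.
have mono c d : c < d -> d < k -> nth 0 t c < nth 0 t d.
  move=> cd dk; apply: (sorted_ltn_nth ltn_trans) => //; rewrite inE zt //.
  exact: ltn_trans dk.
case: (ltngtP a b) => [/mono->//|/mono lt|->]; last by rewrite ltnn.
by apply/negbTE; rewrite -leqNgt ltnW ?lt.
Qed.

Lemma pairwise_subseqP (T : eqType) (r : rel T) (w : seq T) :
  reflect (forall b c, subseq [:: b; c] w -> r b c) (pairwise r w).
Proof.
elim: w => [|a w IHw] /=; first by left => b c.
apply: (iffP andP) => [[/allP aw /IHw rw] b c|rw].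
  by case: eqP => [-> |_]; [rewrite sub1seq; apply: aw | apply: rw].
split; first by apply/allP => c cw; apply: rw; rewrite eqxx sub1seq.
apply/IHw => b c bc; apply: rw; case: ifP => // _.
by apply: subseq_trans bc; apply: subseq_cons.
Qed.

Lemma av132P w :
  reflect (forall a b c, subseq [:: a; b; c] w -> ~~ (a < c < b)) (av132 w).
Proof.
elim: w => [|x w IHw]; first by left => a b c.
apply: (iffP andP) => [[/pairwise_subseqP xw /IHw aw] a b c|aw].
  by rewrite [subseq _ _]/=; case: (a =P x) => [->|_]; [apply: xw | apply: aw].
split; first by apply/pairwise_subseqP => b c bc; apply: aw; rewrite /= eqxx.
apply/IHw => a b c abc; apply: aw; apply: subseq_trans abc (subseq_cons _ _).
Qed.

Lemma pat132E (i : 'I_3) : val (pat132 i) = nth 0 [:: 0; 2; 1] i.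
Proof.
rewrite /pat132; case: tpermP => [->|->|]; rewrite /= ?inordK //.
move=> /eqP + /eqP; rewrite -!val_eqE /= !inordK //.
by case: i => -[|[|[|i]]].
Qed.

Lemma avoids_pat132 n (s : 'S_n) : avoids s pat132 = av132 (word s).
Proof.
apply/idP/av132P => [av a b c abc|av].
  apply: contra av => /andP[ac cb]; apply/contains_patternP.
  exists [:: a; b; c]; split=> // i j; rewrite !pat132E.
  have ab := ltn_trans ac cb.
  case: i j => -[|[|[|i]]] //= _ [[|[|[|j]]]] //= _; lia.
apply/contains_patternP => -[[|a [|b [|c [|d t]]]] [abc // _ ord]].
(* These two pairs of pattern positions yield [a < c] and [c < b], against [av]. *)
have := av a b c abc; have := ord ord0 (inord 2); have := ord (inord 2) (inord 1).
by rewrite !pat132E /= !inordK //= => -> ->.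
Qed.

Lemma inv_wordE w : inv_word w =
  \sum_(i < size w) \sum_(j < size w) ((i < j) && (nth 0 w j < nth 0 w i)).
Proof.
elim: w => [|a w IHw]; first by rewrite big_ord0.
rewrite /= big_ord_recl big_ord_recl /= add0n; congr (_ + _).
  by rewrite -sum1_count (big_nth 0) big_mkord big_mkcond /=; apply: eq_bigr => i _; case: ifP.
rewrite IHw; apply: eq_bigr => i _; rewrite big_ord_recl /= add0n.
by apply: eq_bigr => j _.
Qed.

Lemma inversions_word n (s : 'S_n) : inversions s = inv_word (word s).
Proof.
rewrite inv_wordE size_word /inversions cardsE -sum1_card big_mkcond /=.
rewrite pair_bigA /=; apply: eq_bigr => -[i j] _ /=.
by rewrite !nth_word unfold_in /=; case: ifP.
Qed.

Lemma even_involutions_words k n :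
  even_involutions (idpat k) n = invol_avoiders false k n.
Proof.
rewrite /even_involutions /invol_avoiders -size_filter cardE -(size_map (@word n)).
apply: perm_size; apply: uniq_perm.
- by rewrite map_inj_uniq ?enum_uniq //; apply: word_inj.
- by rewrite filter_uniq // uniq_invol_words.
move=> w; rewrite mem_filter mem_invol_words; apply/mapP/idP => [[s]|].
  rewrite mem_enum inE => /and4P[is_ es a1 ak] ->.
  rewrite -avoids_idpat ak /good perm_word_word -avoids_pat132 a1 size_word.
  by rewrite -involution_word is_ -inversions_word eqbF_neg es eqxx.
move=> /andP[/andP[lw ow] /and3P[/andP[pw aw] ww /eqP sw]].
have [s Es] := word_surj pw sw; exists s => //.
rewrite mem_enum inE involution_word inversions_word avoids_pat132 avoids_idpat Es.
by rewrite ww lw aw -eqbF_neg ow.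
Qed.

(** * Power series of rational functions *)

Local Open Scope ring_scope.

(** The Cauchy product; sequences stand for formal power series. *)
Definition conv (R : nzRingType) (a b : nat -> R) (n : nat) : R :=
  \sum_(i < n.+1) a i * b (n - i)%N.

(** * Algebra of coefficient sequences *)

Section Convolution.
Variable R : comNzRingType.
Implicit Types a b c : nat -> R.

Lemma eq_conv a a' b b' n :
  (forall i, (i <= n)%N -> a i = a' i) -> (forall i, (i <= n)%N -> b i = b' i) ->
  conv a b n = conv a' b' n.
Proof.
move=> aa' bb'; apply: eq_bigr => i _.
by rewrite aa' ?bb' ?leq_subr // -ltnS.
Qed.

Lemma conv_coefM (p q : {poly R}) n : conv (nth 0 p) (nth 0 q) n = (p * q)`_n.
Proof. by rewrite coefM. Qed.

(** Coefficient [n] of a product sees only terms up to [n], so polynomial truncations compute it and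
    pass on the ring laws. *)
Lemma conv_poly a b n N : (n < N)%N ->
  conv a b n = (\poly_(i < N) a i * \poly_(i < N) b i)`_n.
Proof.
move=> nN; rewrite -conv_coefM; apply: eq_conv => i lein;
  by rewrite coef_poly (leq_ltn_trans lein nN).
Qed.

Lemma convC a b n : conv a b n = conv b a n.
Proof. by rewrite !(conv_poly _ _ (ltnSn n)) mulrC. Qed.

Lemma convA a b c n : conv a (conv b c) n = conv (conv a b) c n.
Proof.
rewrite (@eq_conv a (nth 0 (\poly_(i < n.+1) a i)) (conv b c)
  (nth 0 (\poly_(i < n.+1) b i * \poly_(i < n.+1) c i))); last 2 first.
- by move=> i lein; rewrite coef_poly ltnS lein.
- by move=> i lein; apply: conv_poly.
rewrite (@eq_conv (conv a b) (nth 0 (\poly_(i < n.+1) a i * \poly_(i < n.+1) b i))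
  c (nth 0 (\poly_(i < n.+1) c i))); last 2 first.
- by move=> i lein; apply: conv_poly.
- by move=> i lein; rewrite coef_poly ltnS lein.
by rewrite !conv_coefM mulrA.
Qed.

Lemma conv_mulp (p q : {poly R}) a n :
  conv (nth 0 (p * q)) a n = conv (nth 0 p) (conv (nth 0 q) a) n.
Proof. by rewrite convA; apply: eq_conv => // i _; rewrite conv_coefM. Qed.

Lemma convACA a b c d n :
  conv (conv a b) (conv c d) n = conv (conv a c) (conv b d) n.
Proof.
rewrite -!convA; apply: eq_conv => // i _; rewrite !convA.
by apply: eq_conv => // j _; apply: convC.
Qed.

Lemma convDr a b c n : conv a (fun i => b i + c i) n = conv a b n + conv a c n.
Proof. by rewrite -big_split /=; apply: eq_bigr => i _; rewrite mulrDr. Qed.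

Lemma convZr x a b n : conv a (fun i => x * b i) n = x * conv a b n.
Proof. by rewrite /conv mulr_sumr; apply: eq_bigr => i _; rewrite mulrCA. Qed.

(** The series x a(x); the next two definitions are 1 + x a(x) and a(x^2). *)
Definition shift a (n : nat) : R := if n is i.+1 then a i else 0.

Definition one_plus_shift a (n : nat) : R := if n is i.+1 then a i else 1.

Definition stretch a (n : nat) : R := if odd n then 0 else a n./2.

Lemma conv_shiftr a b n : conv a (shift b) n = shift (conv a b) n.
Proof.
rewrite convC; case: n => [|n]; first by rewrite /conv big_ord1 mul0r.
rewrite /conv big_ord_recl mul0r add0r /= -/(conv a b n) convC.
by apply: eq_bigr => i _; rewrite /= subSS.
Qed.

Lemma conv_one_plus_shift a b n :
  conv (one_plus_shift a) b n = b n + shift (conv a b) n.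
Proof.
rewrite {1}/conv big_ord_recl mul1r subn0; congr (_ + _).
by case: n => [|n]; [rewrite big_ord0 | apply: eq_bigr => i _; rewrite /= subSS].
Qed.

Lemma conv_stretch a b n :
  conv (stretch a) b n = \sum_(0 <= i < n.+1 | (i.*2 <= n)%N) a i * b (n - i.*2)%N.
Proof.
(* Only even [j] contribute; each is written as 2i before the sums are exchanged. *)
transitivity (\sum_(j < n.+1) \sum_(i < n.+1 | i.*2 == j :> nat) a i * b (n - j)%N).
  apply: eq_bigr => j _; rewrite /stretch; case: ifP => oj.
    rewrite mul0r big1 // => i /eqP ij.
    by move: oj; rewrite -ij odd_double.
  have lj : (j./2 < n.+1)%N.
    by apply: leq_ltn_trans (ltn_ord j); rewrite leq_half_double -addnn -addSn leq_addl.
  rewrite (big_pred1 (Ordinal lj)) // => i /=; rewrite -val_eqE /=.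
  by rewrite -{1}(odd_double_half j) oj add0n (inj_eq double_inj).
rewrite (exchange_big_dep xpredT) //= big_mkord [RHS]big_mkcond /=.
apply: eq_bigr => i _; case: ifP => lein.
  by rewrite (big_pred1 (Ordinal (lein : i.*2 < n.+1)%N)).
by rewrite big1 // => j /eqP ij; move: lein; rewrite ij -ltnS ltn_ord.
Qed.

(** For odd [n], an even index has an odd complement, where the second factor vanishes. *)
Lemma stretch_conv a b n : conv (stretch a) (stretch b) n = stretch (conv a b) n.
Proof.
rewrite conv_stretch /stretch; case: ifP => on.
  by rewrite big1 // => i lein; rewrite oddB // odd_double on mulr0.
have := odd_double_half n; rewrite on add0n; move: n./2 => m <-.
rewrite /conv big_mkcond /= (@big_cat_nat _ _ _ m.+1) //=; last first.
  by rewrite ltnS -addnn leq_addl.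
rewrite [X in _ + X]big1_seq ?addr0 => [|i]; last first.
  by rewrite mem_index_iota leq_double => /andP[_ /andP[lt _]]; rewrite leqNgt lt.
rewrite big_mkord; apply: eq_bigr => i _.
by rewrite leq_double -ltnS ltn_ord -doubleB odd_double doubleK.
Qed.

End Convolution.

(** * Closure properties of rational functions with a power series *)

Section PowerSeries.
Variable C : numClosedFieldType.
Implicit Types (f g h : C -> C) (a b c : nat -> C) (P : C -> Prop).

(** The exceptional set absorbs the zeros of denominators, where the total functions have
    meaningless values. *)
Definition cofinite P := exists bad : seq C, forall x, x \notin bad -> P x.

Lemma cofinite_and P P' : cofinite P -> cofinite P' -> cofinite (fun x => P x /\ P' x).
Proof.
move=> [s Ps] [t Pt]; exists (s ++ t) => x; rewrite mem_cat => /norP[xs xt].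
by split; [apply: Ps | apply: Pt].
Qed.

Lemma cofinite_imp P P' : (forall x, P x -> P' x) -> cofinite P -> cofinite P'.
Proof. by move=> PP' [s Ps]; exists s => x /Ps /PP'. Qed.

Lemma cofinite_neq0 : cofinite (fun x => x != 0).
Proof. by exists [:: 0] => x; rewrite inE. Qed.

Lemma cofinite_horner (p : {poly C}) : p != 0 -> cofinite (fun x => p.[x] != 0).
Proof.
have [r ->] := closed_field_poly_normal p.
rewrite scaler_eq0 => /norP[p0 _]; exists r => x xr.
by rewrite hornerZ mulf_neq0 // -/(root _ _) root_prod_XsubC.
Qed.

Lemma cofinite_scale P z : z != 0 -> cofinite P -> cofinite (fun x => P (z * x)).
Proof.
move=> z0 [s Ps]; exists [seq y / z | y <- s] => x xs; apply: Ps.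
by apply: contra xs => xs; apply/mapP; exists (z * x); rewrite // mulrAC mulfV ?mul1r.
Qed.

Lemma cofinite_sqr P : cofinite P -> cofinite (fun x => P (x ^+ 2)).
Proof.
(* Both square roots of each bad value are excluded. *)
move=> [s Ps]; exists (map sqrtC s ++ map (fun y => - sqrtC y) s) => x xs.
apply: Ps; apply: contra xs => xs; rewrite mem_cat.
have : sqrtC (x ^+ 2) ^+ 2 == x ^+ 2 by rewrite sqrtCK.
rewrite eqf_sqr => /orP[/eqP E|/eqP E]; apply/orP; [left|right];
  by apply/mapP; exists (x ^+ 2) => //; rewrite E ?opprK.
Qed.

Lemma horner0_neq0 (p : {poly C}) : p.[0] != 0 -> p != 0.
Proof. by apply: contraNneq => ->; rewrite horner0. Qed.

Lemma hps_ext f g a b : cofinite (fun x => f x = g x) -> a =1 b ->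
  has_power_series f a -> has_power_series g b.
Proof.
move=> fg ab [P [Q [Q0 fPQ QaP]]]; exists P, Q; split=> //.
  by move: (cofinite_and fg fPQ); apply: cofinite_imp => x [<-].
by move=> n; rewrite -QaP; apply: eq_bigr => i _; rewrite ab.
Qed.

Lemma hps_poly (p : {poly C}) : has_power_series (horner p) (nth 0 p).
Proof.
exists p, 1; split; first by rewrite hornerC oner_neq0.
  by exists [::] => x _; rewrite hornerC divr1.
by move=> n; rewrite -[LHS]/(conv _ _ _) conv_coefM mul1r.
Qed.

Lemma hps_add f g a b : has_power_series f a -> has_power_series g b ->
  has_power_series (fun x => f x + g x) (fun n => a n + b n).
Proof.
move=> [P [Q [Q0 fPQ QaP]]] [P' [Q' [Q0' fPQ' QaP']]].
exists (P * Q' + P' * Q), (Q * Q'); split.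
- by rewrite hornerM mulf_neq0.
- move: (cofinite_and (cofinite_horner (horner0_neq0 Q0))
    (cofinite_horner (horner0_neq0 Q0'))).
  move/cofinite_and/(_ (cofinite_and fPQ fPQ')); apply: cofinite_imp.
  move=> x [[Qx Qx'] [-> ->]]; rewrite addf_div // hornerD !hornerM //.
move=> n; rewrite -[LHS]/(conv (nth 0 (Q * Q')) (fun i => a i + b i) n) convDr coefD.
congr (_ + _).
  rewrite mulrC conv_mulp -[in RHS]mulrC -conv_coefM.
  by apply: eq_conv => // i _; rewrite -QaP.
rewrite conv_mulp -[in RHS]mulrC -conv_coefM.
by apply: eq_conv => // i _; rewrite -QaP'.
Qed.

Lemma hps_mul f g a b : has_power_series f a -> has_power_series g b ->
  has_power_series (fun x => f x * g x) (conv a b).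
Proof.
move=> [P [Q [Q0 fPQ QaP]]] [P' [Q' [Q0' fPQ' QaP']]].
exists (P * P'), (Q * Q'); split.
- by rewrite hornerM mulf_neq0.
- move: (cofinite_and fPQ fPQ'); apply: cofinite_imp.
  by move=> x [-> ->]; rewrite mulf_div !hornerM.
move=> n; rewrite -[RHS]conv_coefM.
transitivity (conv (conv (nth 0 Q) (nth 0 Q')) (conv a b) n).
  by apply: eq_conv => // i _; rewrite conv_coefM.
by rewrite convACA; apply: eq_conv => i _; [apply: QaP | apply: QaP'].
Qed.

Lemma hps_scalel z f a : has_power_series f a ->
  has_power_series (fun x => z * f x) (fun n => z * a n).
Proof.
move=> [P [Q [Q0 fPQ QaP]]]; exists (z *: P), Q; split => //.
  by move: fPQ; apply: cofinite_imp => x ->; rewrite hornerZ mulrA.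
by move=> n; rewrite -[LHS]/(conv (nth 0 Q) (fun i => z * a i) n) convZr coefZ -QaP.
Qed.

Lemma hps_mulX f a : has_power_series f a ->
  has_power_series (fun x => x * f x) (shift a).
Proof.
move=> [P [Q [Q0 fPQ QaP]]]; exists (P * 'X), Q; split => //.
  by move: fPQ; apply: cofinite_imp => x ->; rewrite hornerMX mulrAC [RHS]mulrC.
move=> n; rewrite -[LHS]/(conv _ _ _) conv_shiftr coefMX.
by case: n => //= n; apply: QaP.
Qed.

Lemma hps_one_plus_mulX f a : has_power_series f a ->
  has_power_series (fun x => 1 + x * f x) (one_plus_shift a).
Proof.
move=> /hps_mulX/(hps_add (hps_poly 1)); apply: hps_ext.
  by exists [::] => x _; rewrite hornerC.
by case=> [|n]; rewrite coefC /= ?addr0 ?add0r.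
Qed.

(** This turns a recurrence of counts into a closed form: a solution of b a = c with b(0) nonzero is
    the series of h / g. *)
Lemma hps_div f g h a b c : has_power_series g b -> has_power_series h c ->
  b 0%N != 0 -> conv b a =1 c -> cofinite (fun x => f x = h x / g x) ->
  has_power_series f a.
Proof.
move=> [P [Q [Q0 gPQ QbP]]] [P' [Q' [Q0' hPQ QcP]]] b0 bac fE.
(* Q b = P in degree 0 gives P(0) = Q(0) b(0), so [P] may enter the denominator. *)
have P0 : P.[0] != 0.
  rewrite horner_coef0 -QbP big_ord1 mulf_neq0 //.
  by rewrite horner_coef0 in Q0.
exists (P' * Q), (Q' * P); split; first by rewrite hornerM mulf_neq0.
  move: (cofinite_and fE (cofinite_and gPQ hPQ)); apply: cofinite_imp.
  by move=> x [-> [-> ->]]; rewrite invf_div mulf_div !hornerM.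
move=> n; rewrite -[LHS]/(conv _ _ _) conv_mulp mulrC -conv_coefM.
transitivity (conv (nth 0 Q') (conv (nth 0 Q) c) n).
  apply: eq_conv => // i _.
  rewrite (@eq_conv _ _ (conv (nth 0 Q) b) _ a) // => [|j _]; last by rewrite -QbP.
  by rewrite -convA; apply: eq_conv => // j _; apply: bac.
rewrite -conv_mulp mulrC conv_mulp.
by apply: eq_conv => // i _; rewrite -QcP.
Qed.

Lemma hps_scale f a z : z != 0 -> has_power_series f a ->
  has_power_series (fun x => f (z * x)) (fun n => z ^+ n * a n).
Proof.
move=> z0 [P [Q [Q0 fPQ QaP]]].
pose sc (p : {poly C}) := \poly_(i < size p) (z ^+ i * p`_i).
have scE p x : (sc p).[x] = p.[z * x].
  rewrite horner_poly horner_coef; apply: eq_bigr => i _.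
  by rewrite exprMn mulrCA mulrA.
have coef_sc p i : (sc p)`_i = z ^+ i * p`_i.
  by rewrite coef_poly; case: ltnP => // /(nth_default 0) ->; rewrite mulr0.
exists (sc P), (sc Q); split; first by rewrite scE mulr0.
  by move: (cofinite_scale z0 fPQ); apply: cofinite_imp => x ->; rewrite !scE.
move=> n; rewrite coef_sc -QaP mulr_sumr; apply: eq_bigr => i _.
by rewrite coef_sc mulrACA -exprD subnKC // -ltnS.
Qed.

Lemma hps_sqr f a : has_power_series f a ->
  has_power_series (fun x => f (x ^+ 2)) (stretch a).
Proof.
move=> [P [Q [Q0 fPQ QaP]]].
have hE (p : {poly C}) x : (p \Po 'X^2).[x] = p.[x ^+ 2].
  by rewrite horner_comp hornerXn.
have coefE (p : {poly C}) i : (p \Po 'X^2)`_i = stretch (nth 0 p) i.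
  by rewrite coef_comp_poly_Xn // dvdn2 divn2 /stretch; case: (odd i).
exists (P \Po 'X^2), (Q \Po 'X^2); split; first by rewrite hE expr0n.
  by move: (cofinite_sqr fPQ); apply: cofinite_imp => x ->; rewrite !hE.
move=> n; rewrite coefE /stretch -QaP -[RHS]/(stretch (conv (nth 0 Q) a) n).
rewrite -stretch_conv; apply: eq_bigr => i _; congr (_ * _); exact: coefE.
Qed.

End PowerSeries.

(** Isolating index 0 gives the remaining sum the shape it has in [invol_avoidersS]. *)
Lemma conv_stretchS (R : comNzRingType) (a b : nat -> R) n :
  conv (stretch a) b n.+1 = a 0%N * b n.+1 +
    \sum_(0 <= i < n | (i.+1.*2 <= n.+1)%N) a i.+1 * b (n.+1 - i.+1.*2)%N.
Proof.
rewrite conv_stretch big_mkcond big_nat_recl //= subn0; congr (_ + _).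
(* The last index [n] drops out because 2(n + 1) > n + 1. *)
rewrite [RHS]big_mkcond big_nat_recr //= ifF ?addr0 //.
by rewrite leqNgt -addnn addSn ltnS addnS ltnS leq_addl.
Qed.

(** * Recurrences of the Chebyshev ratios *)

Section ChebyshevRatios.
Variable C : numClosedFieldType.
Implicit Types x y : C.

Lemma chebUS k y :
  (chebU C k.+1).[y] = 2%:R * y * (chebU C k).[y] - (chebU_pred C k).[y].
Proof.
case: k => [|k]; first by rewrite hornerZ hornerX hornerC /= horner0 mulr1 subr0.
by rewrite [chebU C k.+2]/= hornerD hornerN hornerM hornerZ hornerX.
Qed.

Lemma chebU_opp k y : (chebU C k).[- y] = (- 1) ^+ k * (chebU C k).[y].
Proof.
suff: (chebU C k).[- y] = (- 1) ^+ k * (chebU C k).[y] /\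
  (chebU C k.+1).[- y] = (- 1) ^+ k.+1 * (chebU C k.+1).[y] by case.
elim: k => [|k [IH1 IH2]].
  by rewrite !chebUS /= !(horner0, hornerC) expr0 expr1; split => //; ring.
split=> //; rewrite !(chebUS k.+1) IH2 [chebU_pred C k.+1]/= IH1 !exprS; ring.
Qed.

(** The limit of sin((k+1)t) / sin t at t = 0; it shows that U_k is not the zero polynomial. *)
Lemma chebU_at1 k : (chebU C k).[1] = k.+1%:R.
Proof.
suff: (chebU C k).[1] = k.+1%:R /\ (chebU C k.+1).[1] = k.+2%:R by case.
elim: k => [|k [IH1 IH2]].
  by rewrite chebUS /= !(horner0, hornerC) !mulr1 subr0.
by split=> //; rewrite chebUS IH2 [chebU_pred C k.+1]/= IH1 -!natr1; ring.
Qed.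

Lemma chebU_neq0 k : chebU C k != 0.
Proof.
apply/eqP => U0; have := chebU_at1 k; rewrite U0 horner0 => /esym/eqP.
by rewrite pnatr_eq0.
Qed.

Lemma cofinite_chebU k : cofinite (fun x => (chebU C k).[1 / (2%:R * x)] != 0).
Proof.
have [s Us] := cofinite_horner (chebU_neq0 k).
(* The map x -> 1 / (2x) is its own inverse, so it carries the bad points back. *)
exists [seq 1 / (2%:R * y) | y <- s] => x xs; apply: Us; apply: contra xs => xs.
apply/mapP; exists (1 / (2%:R * x)) => //.
by rewrite !div1r !invfM !invrK mulrA mulVf ?pnatr_eq0 // mul1r.
Qed.

Lemma cofinite_sqrt (P : C -> Prop) : cofinite P -> cofinite (fun x => P (sqrtC x)).
Proof.
move=> [s Ps]; exists [seq y ^+ 2 | y <- s] => x xs; apply: Ps.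
by apply: contra xs => xs; apply/mapP; exists (sqrtC x); rewrite ?sqrtCK.
Qed.

(** Divide U_(k+1) = 2y U_k - U_(k-1) by U_k at y = 1 / (2 sqrt x); the denominator is written to
    fit [one_plus_shift]. *)
Lemma RkS_cofinite k : cofinite (fun x => Rk k.+1 x = 1 / (1 + x * - Rk k x)).
Proof.
move: (cofinite_and (@cofinite_neq0 C) (cofinite_sqrt (cofinite_chebU k))).
apply: cofinite_imp => x [x0 U0]; rewrite /Rk chebUS /=.
have s0 : sqrtC x != 0 by rewrite sqrtC_eq0.
move: (sqrtC x) (sqrtCK x) s0 U0 => s <- s0.
move: (chebU C k).[_] (chebU_pred C k).[_] => u v u0.
have -> : 1 + s ^+ 2 * - (v / (s * u)) = (u - s * v) / u by field; rewrite u0 s0.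
rewrite [RHS]div1r invf_div; congr (_ / _); field; exact: s0.
Qed.

(* [sqrtC (x ^+ 2)] is only [x] up to sign; the parity of U_k absorbs the sign. *)
Lemma Rk_sqr k x : Rk k (x ^+ 2) =
  (chebU_pred C k).[1 / (2%:R * x)] / (x * (chebU C k).[1 / (2%:R * x)]).
Proof.
have : sqrtC (x ^+ 2) ^+ 2 == x ^+ 2 by rewrite sqrtCK.
rewrite eqf_sqr /Rk => /orP[/eqP ->//|/eqP ->].
rewrite mulrN invrN mulrN chebU_opp; case: k => [|k] /=.
  by rewrite !horner0 !mul0r.
rewrite chebU_opp exprS mulN1r !mulNr mulrN opprK mulrCA -mulf_div.
by rewrite mulfV ?mul1r // signr_eq0.
Qed.

(** At y = 1 / (2x) the sum in F_(k+1) is that in F_k plus U_k, and U_(k+1) = U_k / x - U_(k-1);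
    divide both by U_k. *)
Lemma FmS_cofinite k : cofinite (fun x : C =>
  Fm k.+1 x = (1 + x * Fm k x) / (1 + x ^+ 2 * - Rk k (x ^+ 2))).
Proof.
move: (cofinite_and (@cofinite_neq0 C) (cofinite_chebU k)).
apply: cofinite_imp => x [x0]; rewrite /Fm Rk_sqr chebUS big_nat_recr //=.
move: (\sum_(_ <= _ < _) _) (chebU C k).[_] (chebU_pred C k).[_] => S u v u0.
have -> : 1 + x * (1 / (x * u) * S) = (S + u) / u by field; rewrite u0 x0.
have -> : 1 + x ^+ 2 * - (v / (x * u)) = (u - x * v) / u by field; rewrite u0 x0.
rewrite invf_div [RHS]mulrA divfK // mulrC div1r; congr (_ / _); field; exact: x0.
Qed.

End ChebyshevRatios.

(** * Generating functions *)

Section GeneratingFunctions.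
Variable C : numClosedFieldType.

Definition avoiders_seq (k n : nat) : C := (avoiders k n)%:R.
Definition invol_seq (b : bool) (k n : nat) : C := (invol_avoiders b k n)%:R.

Lemma hps_Rk_denom k : has_power_series (@Rk C k) (avoiders_seq k) ->
  has_power_series (fun x => 1 + x * - Rk k x)
    (one_plus_shift (fun n => - avoiders_seq k n)).
Proof.
move=> /(hps_scalel (-1))/hps_one_plus_mulX; apply: hps_ext.
  by exists [::] => x _; rewrite mulN1r.
by case=> //= n; rewrite mulN1r.
Qed.

(** R_k and N_k both vanish at k = 0 and obey the same recurrence. *)
Lemma hps_Rk k : has_power_series (@Rk C k) (avoiders_seq k).
Proof.
elim: k => [|k IHk].
  have := hps_poly (0 : {poly C}); apply: hps_ext.
    by exists [::] => x _; rewrite /Rk /= !horner0 mul0r.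
  by move=> n; rewrite /avoiders_seq avoiders0 coef0.
apply: (hps_div (hps_Rk_denom IHk) (hps_poly 1)).
- by rewrite /= oner_neq0.
- case=> [|n]; rewrite conv_one_plus_shift /avoiders_seq /= coefC /=.
    by rewrite addr0.
  rewrite avoidersS natr_sum big_mkord -big_split big1 //= => i _.
  by rewrite natrM mulNr subrr.
move: (RkS_cofinite C k); apply: cofinite_imp => x ->.
by rewrite hornerC.
Qed.

(** z = 1 serves all involutions and z = -1 the even ones, where the sign records the parity shift
    of the outer blocks. *)
Lemma hps_Rk_denom_sqr k z : z != 0 ->
  has_power_series (fun x : C => 1 + (z * x ^+ 2) * - Rk k (z * x ^+ 2))
    (stretch (fun n => z ^+ n * one_plus_shift (fun n => - avoiders_seq k n) n)).
Proof. by move=> z0; apply: hps_sqr (hps_scale z0 (hps_Rk_denom (hps_Rk k))). Qed.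

Lemma conv_Rk_denom_sqr k z (b : nat -> C) n :
  conv (stretch (fun n => z ^+ n * one_plus_shift (fun n => - avoiders_seq k n) n)) b n.+1
  = b n.+1 - \sum_(0 <= i < n | (i.+1.*2 <= n.+1)%N)
      z ^+ i.+1 * avoiders_seq k i * b (n.+1 - i.+1.*2)%N.
Proof.
rewrite conv_stretchS /= expr0 !mul1r; congr (_ + _).
by rewrite -sumrN; apply: eq_bigr => i _; rewrite mulrN mulNr.
Qed.

Definition all_invol_seq k n := invol_seq false k n + invol_seq true k n.

(** Adding the two parities cancels the parity shift, leaving the recurrence of A_k, which F_k
    shares. *)
Lemma hps_Fm k : has_power_series (@Fm C k) (all_invol_seq k).
Proof.
elim: k => [|k IHk].
  have := hps_poly (0 : {poly C}); apply: hps_ext.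
    by exists [::] => x _; rewrite /Fm big_geq // mulr0 horner0.
  by move=> n; rewrite /all_invol_seq /invol_seq !invol_avoiders0 coef0 addr0.
apply: (hps_div (hps_Rk_denom_sqr k (oner_neq0 C)) (hps_one_plus_mulX IHk)).
- by rewrite /stretch /= mulr1 oner_neq0.
- case=> [|n].
    rewrite /conv big_ord1 /stretch /= !mul1r /all_invol_seq /invol_seq.
    by rewrite !invol_avoidersS0 /= addr0.
  rewrite conv_Rk_denom_sqr /= {1}/all_invol_seq /invol_seq !invol_avoidersS.
  apply/eqP; rewrite subr_eq !natrD !natr_sum addrACA -big_split /=; apply/eqP.
  congr (_ + _); apply: eq_bigr => i _; rewrite expr1n mul1r /avoiders_seq.
  rewrite /all_invol_seq /invol_seq !natrM.
  by case: (odd i); rewrite /=; ring.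
move: (FmS_cofinite C k); apply: cofinite_imp => x ->.
by rewrite !mul1r.
Qed.

(** The right-hand side of the theorem, named for induction on [k]. *)
Definition even_sum (k : nat) (x : C) : C :=
  \sum_(0 <= j < k)
    (x ^+ j * (1 + x ^+ 2 * Rk_even (k - 1 - j) (x ^+ 2) * Fm (k - j) x) *
     \prod_((k - j)%N <= i < k.+1) Rk i (- x ^+ 2)).

(** Term 0 stands alone, and term j + 1 is x R_(k+1)(-x^2) times term j of [even_sum k]. *)
Lemma even_sumS k x : even_sum k.+1 x = Rk k.+1 (- x ^+ 2) *
  (1 + x * even_sum k x + x ^+ 2 * Rk_even k (x ^+ 2) * Fm k.+1 x).
Proof.
rewrite /even_sum big_nat_recl // expr0 mul1r !subn0 subn1 /= big_nat1.
rewrite [1 + x * _ + _]addrAC mulrDr [in RHS]mulrC; congr (_ + _).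
rewrite mulrCA mulr_sumr mulr_sumr; apply: eq_big_nat => j /andP[_ ltjk].
rewrite subSS -subnDA add1n big_nat_recr /=; last by rewrite ltnW // ltnS leq_subr.
by rewrite exprS; ring.
Qed.

(** Averaging kills the odd coefficients: R^e_k counts the avoiders of even length. *)
Lemma hps_Rk_even k : has_power_series (@Rk_even C k)
  (fun n => 1 / 2%:R * (avoiders_seq k n + (-1) ^+ n * avoiders_seq k n)).
Proof.
have n1 : (-1 : C) != 0 by rewrite oppr_eq0 oner_neq0.
have := hps_scalel (1 / 2%:R) (hps_add (hps_Rk k) (hps_scale n1 (hps_Rk k))).
apply: hps_ext => //; exists [::] => x _.
by rewrite /Rk_even mulN1r.
Qed.

(** Since R_(k+1)(-x^2) is the inverse of 1 + x^2 R_k(-x^2), [even_sumS] is the recurrence of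
    E_k. *)
Lemma hps_even_sum k : has_power_series (even_sum k) (invol_seq false k).
Proof.
elim: k => [|k IHk].
  have := hps_poly (0 : {poly C}); apply: hps_ext.
    by exists [::] => x _; rewrite /even_sum big_geq // horner0.
  by move=> n; rewrite /invol_seq invol_avoiders0 coef0.
have n1 : (-1 : C) != 0 by rewrite oppr_eq0 oner_neq0.
have hR := hps_sqr (hps_mulX (hps_Rk_even k)).
have hN := hps_add (hps_one_plus_mulX IHk) (hps_mul hR (hps_Fm k.+1)).
apply: (hps_div (hps_Rk_denom_sqr k n1) hN).
- by rewrite /stretch /= mulr1 oner_neq0.
- case=> [|n].
    rewrite /conv !big_ord1 /stretch /= /invol_seq.
    by rewrite !invol_avoidersS0 /= mul0r addr0 !mul1r.
  rewrite conv_Rk_denom_sqr conv_stretchS /= {1}/invol_seq !invol_avoidersS.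
  rewrite natrD natr_sum -addrA mul0r add0r; congr (_ + _).
  rewrite -sumrB; apply: eq_bigr => i _; rewrite natrM /all_invol_seq /avoiders_seq /invol_seq.
  (* For odd [i] the parity is kept and the two even counts cancel; for even [i] the odd and even
     counts add up to all involutions. *)
  by rewrite exprS -signr_odd; case: (odd i); rewrite /=; field.
move: (cofinite_sqr (cofinite_scale n1 (RkS_cofinite C k))). apply: cofinite_imp => x.
by rewrite even_sumS -[- x ^+ 2]mulN1r => ->; rewrite mulrC div1r.
Qed.

End GeneratingFunctions.

Theorem theorem3p5 (C : numClosedFieldType) (k : nat) (hk : (1 <= k)%N) :
  has_power_series
    (fun x : C =>
       \sum_(0 <= j < k)
         (x ^+ j *
          (1 + x ^+ 2 * Rk_even (k - 1 - j) (x ^+ 2) * Fm (k - j) x) *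
          \prod_((k - j)%N <= i < k.+1) Rk i (- x ^+ 2)))
    (fun n => (even_involutions (idpat k) n)%:R).
Proof.
apply: hps_ext (hps_even_sum C k); first by exists [::].
by move=> n; rewrite even_involutions_words.
Qed.
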